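(* For every integer $n\geq 1$, the following identities hold in $\mathbb{Z}[x]$: (1) $F_n(3x) = C_{n-1}(x)-\sum_{k=1}^{n-2}\bigl(3xC_{n-k-1}(x)-2C_{n-k-2}(x)\bigr)F_k(3x)$; (2) $F_n(3x)+3xF_{n-1}(3x) = B_{n}(x)-\sum_{k=1}^{n-2}\bigl(3xB_{n-k}(x)-2B_{n-k-1}(x)\bigr)F_k(3x)$; (3) $9x^2F_{2n}(3x) = C_{2n+1}(x)-C_{2n-1}(x)-(27x^2-4)\sum_{k=0}^{n-1}C_{2(n-k)-1}(x)F_{2k+1}(3x)$; (4) $6xF_{2n+1}(3x) = B_{2(n+1)}(x)-B_{2n}(x)-(27x^2-4)\sum_{k=0}^{n-1}B_{2(n-k)}(x)F_{2k+1}(3x)$; (5) $F_{2n}(3x)+F_{2n-2}(3x) = 3xB_{2n-1}(x)-(27x^2-4)\sum_{k=1}^{n-1}B_{2(n-k)-1}(x)F_{2k}(3x)$; (6) $9x^2F_{2n-1}(3x) = 3xC_{2n-1}(x)-(27x^2-4)\sum_{k=1}^{n-1}C_{2(n-k)-1}(x)F_{2k}(3x)$; (7) $6xF_{2n}(3x) = 3xB_{2n}(x)-(27x^2-4)\sum_{k=1}^{n-1}B_{2(n-k)}(x)F_{2k}(3x)$.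
   Context: The balancing polynomials $B_n(x)$ and Lucas-balancing polynomials $C_n(x)$ both satisfy the recurrence $w_n(x)=6xw_{n-1}(x)-w_{n-2}(x)$ for $n\geq 2$, with initial values $B_0(x)=0$, $B_1(x)=1$ and $C_0(x)=1$, $C_1(x)=3x$. The (Catalan) Fibonacci polynomials $F_n(x)$ are defined by $F_0(x)=0$, $F_1(x)=1$, $F_n(x)=xF_{n-1}(x)+F_{n-2}(x)$ for $n\geq 2$; $F_n(3x)$ denotes the polynomial obtained by substituting $3x$ for $x$. A sum whose upper limit is smaller than its lower limit is $0$. *)

(* Defs.v *)
From mathcomp Require Import all_boot all_order all_algebra.

Set Implicit Arguments.
Unset Strict Implicit.
Unset Printing Implicit Defensive.

Import GRing.Theory.
Local Open Scope ring_scope.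

Fixpoint balancing (n : nat) : {poly int} :=
  match n with
  | 0 => 0
  | 1 => 1
  | (m.+1 as k).+1 => 6 * 'X * balancing k - balancing m
  end.

Fixpoint lucas_balancing (n : nat) : {poly int} :=
  match n with
  | 0 => 1
  | 1 => 3 * 'X
  | (m.+1 as k).+1 => 6 * 'X * lucas_balancing k - lucas_balancing m
  end.

(* Catalan's Fibonacci polynomials, not Jacobsthal's. *)
Fixpoint fibonacci (n : nat) : {poly int} :=
  match n with
  | 0 => 0
  | 1 => 1
  | (m.+1 as k).+1 => 'X * fibonacci k + fibonacci m
  end.

Definition fibonacci3 (n : nat) : {poly int} := fibonacci n \Po (3 * 'X).

(* Main.v *)
(* If [f_(k+2) = q f_(k+1) + e f_k] and [w_(k+2) = p w_(k+1) + d w_k], then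
   differences of [w_(n+1-k) f_(k+1) + e w_(n-k) f_k] in [k] are convolution terms
   of [w] and [f], so the convolution telescopes. Identities (1) and (2) are the
   case of the sequences themselves; (3)-(7) are the case of their bisections, where
   [27 x^2 - 4] is the difference of the middle coefficients [36 x^2 - 2] and
   [9 x^2 + 2]. *)
Require Import Defs.
From mathcomp Require Import all_boot all_order all_algebra.
From mathcomp Require Import ring zify.

Import GRing.Theory.
Local Open Scope ring_scope.

Lemma convolution_telescope (R : comNzRingType) (p q d e : R) (w f : nat -> R)
    (n : nat) :
  (forall m, w m.+2 = p * w m.+1 + d * w m) ->
  (forall m, f m.+2 = q * f m.+1 + e * f m) ->
  \sum_(0 <= k < n)
     ((p - q) * w (n - k)%N + (d - e) * w (n - k.+1)%N) * f k.+1
  = w n.+1 * f 1%N + e * (w n * f 0%N) - (w 1%N * f n.+1 + e * (w 0%N * f n)).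
Proof.
move=> wE fE.
pose E k := - (w (n.+1 - k)%N * f k.+1 + e * (w (n - k)%N * f k)).
transitivity (E n - E 0%N); last first.
  by rewrite /E !subn0 subSnn subnn; ring.
rewrite -telescope_sumr //; apply: eq_big_nat => k /andP[_ lt_kn].
(* With [n = m + k.+1] every truncated difference becomes a successor, so both recurrences apply by
   rewriting. *)
have [m nE] : exists m, n = (m + k.+1)%N by exists (n - k.+1)%N; lia.
rewrite /E nE addnK subSS.
have -> : (m + k.+1 - k = m.+1)%N by lia.
have -> : ((m + k.+1).+1 - k = m.+2)%N by lia.
by rewrite wE fE; ring.
Qed.

(** The characteristic roots get squared: from sum [a] and product [-b] the new sum is [a^2 + 2b]
    and the new product [b^2]. *)
Lemma bisection_rec (R : comNzRingType) (a b : R) (w : nat -> R) :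
  (forall m, w m.+2 = a * w m.+1 + b * w m) ->
  forall m, w m.+4 = (a ^+ 2 + 2 * b) * w m.+2 + - b ^+ 2 * w m.
Proof. by move=> wE m; rewrite !wE; ring. Qed.

Lemma balancingSS m :
  balancing m.+2 = 6 * 'X * balancing m.+1 + (-1) * balancing m.
Proof. by rewrite /= mulN1r. Qed.

Lemma lucas_balancingSS m :
  lucas_balancing m.+2
  = 6 * 'X * lucas_balancing m.+1 + (-1) * lucas_balancing m.
Proof. by rewrite /= mulN1r. Qed.

Lemma fibonacci3_0 : fibonacci3 0 = 0.
Proof. exact: comp_poly0. Qed.

Lemma fibonacci3_1 : fibonacci3 1 = 1.
Proof. exact: comp_polyC. Qed.

Lemma fibonacci3SS m :
  fibonacci3 m.+2 = 3 * 'X * fibonacci3 m.+1 + 1 * fibonacci3 m.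
Proof. by rewrite /fibonacci3 /= comp_polyD comp_polyM comp_polyX mul1r. Qed.

(* Extends a recurrence one step to the left: [x] plays the role of [w_(-1)]. *)
Definition prepend (T : Type) (x : T) (w : nat -> T) (m : nat) : T :=
  if m is k.+1 then w k else x.

Lemma prependE (T : Type) (x : T) (w : nat -> T) m :
  (0 < m)%N -> prepend T x w m = w (m - 1)%N.
Proof. by case: m => // m _; rewrite subn1. Qed.

Lemma prepend_rec (R : pzRingType) (a b x : R) (w : nat -> R) :
  w 1%N = a * w 0%N + b * x ->
  (forall m, w m.+2 = a * w m.+1 + b * w m) ->
  forall m, prepend R x w m.+2 = a * prepend R x w m.+1 + b * prepend R x w m.
Proof. by move=> w1E wE [|m] /=. Qed.

(** Both bisections end in the same coefficient, as [(-1)^2 = 1^2]. Hence [d - e] vanishes in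
    [convolution_telescope] and each summand is a single product. *)
Lemma bisection_convolution (w f : nat -> {poly int}) (n : nat) :
  (forall m, w m.+2 = 6 * 'X * w m.+1 + (-1) * w m) ->
  (forall m, f m.+2 = 3 * 'X * f m.+1 + 1 * f m) ->
  (27 * 'X^2 - 4) * \sum_(0 <= k < n) w (2 * (n - k))%N * f (2 * k.+1)%N
  = w (2 * n.+1)%N * f 2%N - w (2 * n)%N * f 0%N
    - w 2%N * f (2 * n.+1)%N + w 0%N * f (2 * n)%N.
Proof.
move=> wE fE.
have w2E m : w (2 * m.+2)%N
    = (36 * 'X^2 - 2) * w (2 * m.+1)%N + (-1) * w (2 * m)%N.
  by rewrite !mulnS (bisection_rec _ _ _ _ wE); ring.
have f2E m : f (2 * m.+2)%N
    = (9 * 'X^2 + 2) * f (2 * m.+1)%N + (-1) * f (2 * m)%N.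
  by rewrite !mulnS (bisection_rec _ _ _ _ fE); ring.
have := convolution_telescope _ _ _ _ _
  (fun m => w (2 * m)%N) (fun m => f (2 * m)%N) n w2E f2E.
rewrite /= !muln0 !muln1 => H; rewrite mulr_sumr.
transitivity (w (2 * n.+1)%N * f 2%N + -1 * (w (2 * n)%N * f 0%N)
  - (w 2%N * f (2 * n.+1)%N + -1 * (w 0%N * f (2 * n)%N))); last by ring.
by rewrite -H; apply: eq_bigr => k _; ring.
Qed.

Theorem corollary4 (n : nat) (hn : (1 <= n)%N) :
  let B := balancing in
  let C := lucas_balancing in
  let F3 := fibonacci3 in
  (* (1) *)
  (F3 n = C (n - 1)%N
     - \sum_(1 <= k < (n - 2).+1)
         (3 * 'X * C (n - k - 1)%N - 2 * C (n - k - 2)%N) * F3 k)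
  /\
  (* (2) *)
  (F3 n + 3 * 'X * F3 (n - 1)%N = B n
     - \sum_(1 <= k < (n - 2).+1)
         (3 * 'X * B (n - k)%N - 2 * B (n - k - 1)%N) * F3 k)
  /\
  (* (3) *)
  (9 * 'X^2 * F3 (2 * n)%N = C (2 * n + 1)%N - C (2 * n - 1)%N
     - (27 * 'X^2 - 4) *
       \sum_(0 <= k < n) C (2 * (n - k) - 1)%N * F3 (2 * k + 1)%N)
  /\
  (* (4) *)
  (6 * 'X * F3 (2 * n + 1)%N = B (2 * (n + 1))%N - B (2 * n)%N
     - (27 * 'X^2 - 4) *
       \sum_(0 <= k < n) B (2 * (n - k))%N * F3 (2 * k + 1)%N)
  /\
  (* (5) *)
  (F3 (2 * n)%N + F3 (2 * n - 2)%N = 3 * 'X * B (2 * n - 1)%N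
     - (27 * 'X^2 - 4) *
       \sum_(1 <= k < n) B (2 * (n - k) - 1)%N * F3 (2 * k)%N)
  /\
  (* (6) *)
  (9 * 'X^2 * F3 (2 * n - 1)%N = 3 * 'X * C (2 * n - 1)%N
     - (27 * 'X^2 - 4) *
       \sum_(1 <= k < n) C (2 * (n - k) - 1)%N * F3 (2 * k)%N)
  /\
  (* (7) *)
  (6 * 'X * F3 (2 * n)%N = 3 * 'X * B (2 * n)%N
     - (27 * 'X^2 - 4) *
       \sum_(1 <= k < n) B (2 * (n - k))%N * F3 (2 * k)%N).
Proof.
move=> B C F3.
have BE : forall m, B m.+2 = 6 * 'X * B m.+1 + (-1) * B m := balancingSS.
have CE : forall m, C m.+2 = 6 * 'X * C m.+1 + (-1) * C m := lucas_balancingSS.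
have FE : forall m, F3 m.+2 = 3 * 'X * F3 m.+1 + 1 * F3 m := fibonacci3SS.
have [B0 B1] : B 0%N = 0 /\ B 1%N = 1 by [].
have [C0 C1] : C 0%N = 1 /\ C 1%N = 3 * 'X by [].
have F0 : F3 0%N = 0 := fibonacci3_0.
have F1 : F3 1%N = 1 := fibonacci3_1.
(* Generalizing makes the sequences opaque: from here only recurrences and initial values are
   available, and [/=] cannot unfold them. *)
move: B C F3 BE CE FE B0 B1 C0 C1 F0 F1 => B C F BE CE FE B0 B1 C0 C1 F0 F1.
have B2 : B 2%N = 6 * 'X by rewrite BE B1 B0; ring.
have F2 : F 2%N = 3 * 'X by rewrite FE F1 F0; ring.
(* The values at index -1 are forced by running the recurrences backwards. The shift turns the odd
   indices of (3)-(6) into even ones. *)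
pose B' := prepend {poly int} (-1) B.
pose C' := prepend {poly int} (3 * 'X) C.
pose F' := prepend {poly int} 1 F.
have B'E : forall m, B' m.+2 = 6 * 'X * B' m.+1 + (-1) * B' m.
  by apply: prepend_rec BE; rewrite B0 B1; ring.
have C'E : forall m, C' m.+2 = 6 * 'X * C' m.+1 + (-1) * C' m.
  by apply: prepend_rec CE; rewrite C0 C1; ring.
have F'E : forall m, F' m.+2 = 3 * 'X * F' m.+1 + 1 * F' m.
  by apply: prepend_rec FE; rewrite F0 F1; ring.
case: n hn => // n _; do 6?split.
(* For index 1 the bound [n - 2] truncates to 0 and the sum is empty. Otherwise the index is [n.+2],
   and the convolution equals [C n.+1 - F n.+2]. *)
- case: n => [|n]; first by rewrite big_geq // F1 C0; ring.
  have := convolution_telescope _ _ _ _ _ C F n CE FE.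
  rewrite !subSS !subn0 big_add1 C1 C0 F1 F0 => H.
  transitivity (C n.+1 - (C n.+1 * 1 + 1 * (C n * 0)
    - (3 * 'X * F n.+1 + 1 * (1 * F n)))); first by rewrite FE; ring.
  rewrite -H; congr (_ - _); apply: eq_big_nat => k /andP[_ lt_kn].
  have -> : (n.+2 - k.+1 - 1 = n - k)%N by lia.
  have -> : (n.+2 - k.+1 - 2 = n - k.+1)%N by lia.
  by ring.
- case: n => [|n]; first by rewrite big_geq // F1 F0 B1; ring.
  (* Starting [B] at index 1 gives the boundary term [6x F n.+1 + F n], which is
     [F n.+2 + 3x F n.+1]. *)
  have := convolution_telescope _ _ _ _ _ (B \o succn) F n (fun m => BE m.+1) FE.
  rewrite /= !subSS !subn0 big_add1 B2 B1 F1 F0 => H.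
  transitivity (B n.+2 - (B n.+2 * 1 + 1 * (B n.+1 * 0)
    - (6 * 'X * F n.+1 + 1 * (1 * F n)))); first by rewrite FE; ring.
  rewrite -H; congr (_ - _); apply: eq_big_nat => k /andP[_ lt_kn].
  have -> : (n.+2 - k.+1 = (n - k).+1)%N by lia.
  have -> : ((n - k).+1 - 1 = (n - k.+1).+1)%N by lia.
  by ring.
(* As [C' 0] and [C' 2] are both [3x], the boundary contains [3x] times a difference of [F] at
   indices two apart, which the recurrence turns into [9x^2 F]. The same happens in (6). *)
- have -> : \sum_(0 <= k < n.+1) C (2 * (n.+1 - k) - 1)%N * F (2 * k + 1)%N
      = \sum_(0 <= k < n.+1) C' (2 * (n.+1 - k))%N * F' (2 * k.+1)%N.
    apply: eq_big_nat => k /andP[_ lt_kn].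
    rewrite /C' /F' !prependE; [|lia..].
    by congr (C _ * F _); lia.
  rewrite (bisection_convolution _ _ _ C'E F'E).
  rewrite !(mulnS, add2n, addn1, subn1, muln0) /= C1 F1 !FE; ring.
- have -> : \sum_(0 <= k < n.+1) B (2 * (n.+1 - k))%N * F (2 * k + 1)%N
      = \sum_(0 <= k < n.+1) B (2 * (n.+1 - k))%N * F' (2 * k.+1)%N.
    apply: eq_big_nat => k /andP[_ lt_kn].
    rewrite /F' prependE; last by lia.
    by congr (B _ * F _); lia.
  rewrite (bisection_convolution _ _ _ BE F'E).
  rewrite !(mulnS, add2n, addn1, subn1, muln0) /= B2 B0 F1; ring.
(* Here [B' 0 = -1] and [B' 2 = 1], so the two boundary values of [F] add up. *)
- rewrite big_add1 /=.
  have -> : \sum_(0 <= k < n) B (2 * (n.+1 - k.+1) - 1)%N * F (2 * k.+1)%N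
      = \sum_(0 <= k < n) B' (2 * (n - k))%N * F (2 * k.+1)%N.
    apply: eq_big_nat => k /andP[_ lt_kn].
    by rewrite /B' prependE ?subSS //; lia.
  rewrite (bisection_convolution _ _ _ B'E FE).
  rewrite !(mulnS, add2n, subn1, subn2, muln0) /= B1 F0 F2; ring.
- rewrite big_add1 /=.
  have -> : \sum_(0 <= k < n) C (2 * (n.+1 - k.+1) - 1)%N * F (2 * k.+1)%N
      = \sum_(0 <= k < n) C' (2 * (n - k))%N * F (2 * k.+1)%N.
    apply: eq_big_nat => k /andP[_ lt_kn].
    by rewrite /C' prependE ?subSS //; lia.
  rewrite (bisection_convolution _ _ _ C'E FE).
  rewrite !(mulnS, add2n, subn1, muln0) /= C1 F0 F2 FE; ring.
- rewrite big_add1 /=.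
  under eq_bigr do rewrite subSS.
  rewrite (bisection_convolution _ _ _ BE FE).
  rewrite !(mulnS, add2n, muln0) B2 B0 F0 F2; ring.
Qed.
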